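(* Let $d\in\mathbb{N}$ and let $(V_n)_{n=1}^\infty$ be a sequence of (not necessarily linear) function spaces (sets) $V_n$ of bounded real-valued functions on $[0,1]^d$ such that $$E_n(f):=\inf\{\|f-g\|_{C([0,1]^d)}:g\in V_n\}$$ fulfills, on the Banach space $X=C([0,1]^d)$, for all $m,n\in\mathbb{N}$, $f,f_1,\dots,f_m\in X$, and $c\in\mathbb{R}$, the conditions $$E_{m\cdot n}\left(\sum_{k=1}^m f_k\right)\leq\sum_{k=1}^m E_n(f_k),\quad E_n(cf)=|c|E_n(f),\quad E_n(f)\leq D_n\|f\|_X,\quad E_n(f)\geq E_{n+1}(f),$$ where the constant $D_n$ is independent of $f$. Let $\tau:\mathbb{N}\to\mathbb{N}$, let $$X_n:=\left\{\frac{j}{\tau(n)}:j\in\{0,1,\dots,\tau(n)\}\right\}^d\subset[0,1]^d,$$ and let $$V_{n,\tau(n)}:=\{h:X_n\to\mathbb{R}:\text{ a function } g\in V_n\text{ exists with } h(\mathbf{x})=g(\mathbf{x})\text{ for all }\mathbf{x}\in X_n\}.$$ Let $\varphi:[1,\infty)\to(0,\infty)$ be strictly decreasing with $\lim_{x\to\infty}\varphi(x)=0$ and such that for each $0<\lambda<1$ there are a real number $X_0=X_0(\lambda)\geq\lambda^{-1}$ and a constant $C_\lambda>0$ such that $\varphi(\lambda x)\leq C_\lambda\varphi(x)$ for all $x>X_0$. Suppose there are $n_0\in\mathbb{N}$ and a constant $C>0$ independent of $n$ such that for all $n\geq n_0$ $$\operatorname{VC-dim}(V_{n,\tau(n)})<[\tau(n)]^d\quad\text{and}\quad\tau(4n)\leq\frac{C}{\varphi(n)}.$$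 Then, for $r\in\mathbb{N}$ and each abstract modulus of smoothness $\omega$ satisfying $\lim_{\delta\to 0+}\frac{\omega(\delta)}{\delta}=\infty$, there exists a counterexample $f_\omega\in C([0,1]^d)$ such that $$\omega_r(f_\omega,\delta)_{\infty,(0,1)^d}=O(\omega(\delta^r))\ \text{ for }\delta\to 0+\quad\text{and}\quad E_n(f_\omega)\neq o(\omega([\varphi(n)]^r))\ \text{ for } n\to\infty.$$
   Context: $\|\cdot\|_{C([0,1]^d)}$ denotes the sup-norm on $[0,1]^d$. VC dimension of a set $V$ of functions $g:Y\to\mathbb{R}$: with the Heaviside function $H(x)=0$ for $x<0$, $H(x)=1$ for $x\geq 0$, $\operatorname{VC-dim}(V)$ is the largest cardinality $k$ of a subset $\{x_1,\dots,x_k\}\subset Y$ such that for each sign sequence $s_1,\dots,s_k\in\{-1,1\}$ a function $g\in V$ exists with $H(g(x_i))=H(s_i)$ for $1\leq i\leq k$. An abstract modulus of smoothness is a continuous, increasing function $\omega:[0,\infty)\to[0,\infty)$ such that for all $\delta_1,\delta_2>0$: $0=\omega(0)<\omega(\delta_1)\leq\omega(\delta_1+\delta_2)\leq\omega(\delta_1)+\omega(\delta_2)$. For open $\Omega\subset\mathbb{R}^d$, $\boldsymbol{\nu}\in\mathbb{R}^d$, let $\Delta_{\boldsymbol{\nu}}^r f(\mathbf{x}):=\sum_{j=0}^r(-1)^{r-j}\binom{r}{j}f(\mathbf{x}+j\boldsymbol{\nu})$ and $\Omega(\boldsymbol{\nu}):=\{\mathbf{x}\in\Omega:\mathbf{x}+t\boldsymbol{\nu}\in\Omega,\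 0\leq t\leq 1\}$. The $r$th radial modulus of smoothness of $f\in C(\overline{\Omega})$ is $\omega_r(f,\delta)_{\infty,\Omega}:=\sup\{\|\Delta_{\boldsymbol{\nu}}^r f\|_{C(\overline{\Omega(r\boldsymbol{\nu})})}:\boldsymbol{\nu}\in\mathbb{R}^d,\ |\boldsymbol{\nu}|\leq\delta\}$ (sup-norms). $E_n(f)\neq o(a_n)$ means $\limsup_{n\to\infty}E_n(f)/a_n>0$. *)

(* Defs.v *)
From HB Require Import structures.
From mathcomp Require Import all_boot all_order all_algebra.
From mathcomp Require Import all_classical all_reals all_analysis.

Set Implicit Arguments.
Unset Strict Implicit.
Unset Printing Implicit Defensive.

Import Order.TTheory GRing.Theory Num.Theory.
Import numFieldNormedType.Exports.

Local Open Scope classical_set_scope.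
Local Open Scope ring_scope.

(* Functions on [0,1]^d are represented by total functions 'rV[R]_d -> R of
   which only the values on the cube matter. *)

Definition cube (R : realType) (d : nat) : set 'rV[R]_d :=
  [set x | forall i, 0 <= x ord0 i <= 1].
Arguments cube : clear implicits.

Definition open_cube (R : realType) (d : nat) : set 'rV[R]_d :=
  [set x | forall i, 0 < x ord0 i < 1].
Arguments open_cube : clear implicits.

Definition Ccube (R : realType) (d : nat) : set ('rV[R]_d -> R) :=
  [set f | {within cube R d, continuous f}].

(* [sup] is 0 on the empty set and on unbounded sets; below, [supnorm] is only
   applied to functions that are bounded on [A]. *)
Definition supnorm (R : realType) (T : Type) (A : set T) (f : T -> R) : R :=
  sup [set `|f x| | x in A].

(* Extended-real valued, so that the infimum over an empty [W] is +oo. *)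
Definition best_approx (R : realType) (d : nat) (W : set ('rV[R]_d -> R))
    (f : 'rV[R]_d -> R) : \bar R :=
  ereal_inf [set (supnorm (cube R d) (f \- g))%:E | g in W].

Definition heaviside (R : realType) (x : R) : R := if x < 0 then 0 else 1.

Definition shatters (R : realType) (Y : Type) (V : set (Y -> R)) (k : nat)
    (x : 'I_k -> Y) : Prop :=
  forall s : 'I_k -> R, (forall i, s i = -1 \/ s i = 1) ->
    exists2 g, V g & forall i, heaviside (g (x i)) = heaviside (s i).

(* The k-element subsets {x_1, ..., x_k} of Y are given by injective
   enumerations.  The value is +oo if there is no largest such k. *)
Definition VCdim (R : realType) (Y : Type) (V : set (Y -> R)) : \bar R :=
  ereal_sup [set (k%:R : R)%:E | k in
    [set k : nat | exists2 x : 'I_k -> Y, injective x & shatters V x]].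

Definition grid (R : realType) (d t : nat) : set 'rV[R]_d :=
  [set x | forall i, exists2 j : nat, (j <= t)%N & x ord0 i = j%:R / t%:R].
Arguments grid : clear implicits.

Definition restr_grid (R : realType) (d t : nat) (W : set ('rV[R]_d -> R)) :
    set (grid R d t -> R) :=
  [set h | exists2 g, W g & forall x : grid R d t, h x = g (\val x)].
Arguments restr_grid {R d} t W _.

Definition eucl_norm (R : realType) (d : nat) (v : 'rV[R]_d) : R :=
  Num.sqrt (\sum_(i < d) v ord0 i ^+ 2).

Definition fwd_diff (R : realType) (d r : nat) (v : 'rV[R]_d)
    (f : 'rV[R]_d -> R) (x : 'rV[R]_d) : R :=
  \sum_(j < r.+1) (-1) ^+ (r - j) * 'C(r, j)%:R * f (x + j%:R *: v).

Definition translatable (R : realType) (d : nat) (U : set 'rV[R]_d)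
    (v : 'rV[R]_d) : set 'rV[R]_d :=
  [set x | U x /\ forall t : R, 0 <= t <= 1 -> U (x + t *: v)].

Definition radial_modulus (R : realType) (d : nat) (U : set 'rV[R]_d) (r : nat)
    (f : 'rV[R]_d -> R) (delta : R) : R :=
  sup [set supnorm (closure (translatable U (r%:R *: v))) (fwd_diff r v f)
      | v in [set v : 'rV[R]_d | eucl_norm v <= delta]].

(* "Increasing" is weak, as in the inequality omega a <= omega (a + b). *)
Record abstract_modulus (R : realType) (omega : R -> R) : Prop := {
  modulus_continuous : {within `[0, +oo[, continuous omega};
  modulus_ge0 : forall a, 0 <= a -> 0 <= omega a;
  modulus_increasing : forall a b, 0 <= a -> a <= b -> omega a <= omega b;
  modulus_at0 : omega 0 = 0;
  modulus_gt0 : forall a, 0 < a -> 0 < omega a;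
  modulus_subadditive : forall a b, 0 < a -> 0 < b ->
    omega a <= omega (a + b) <= omega a + omega b }.

(* E_n <> o(a_n) *)
Definition not_littleo (R : realType) (E : nat -> \bar R) (a : nat -> R) :
    Prop :=
  (0 < limn_esup (fun n => E n * (a n)^-1%:E))%E.

(* Main.v *)
Require Import Defs.
From HB Require Import structures.
From mathcomp Require Import all_boot all_order all_algebra.
From mathcomp Require Import all_classical all_reals all_analysis.
From mathcomp Require Import ring lra.

Set Implicit Arguments.
Unset Strict Implicit.
Unset Printing Implicit Defensive.

Import Order.TTheory GRing.Theory Num.Theory.
Import numFieldNormedType.Exports.

Local Open Scope classical_set_scope.
Local Open Scope ring_scope.

(** The counterexample is obtained by a gliding hump argument.

    Since the VC dimension of [V n] restricted to the grid of mesh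
    [1 / tau n] is less than [tau n ^ d], some sign pattern on [tau n ^ d]
    grid points is not realized by any element of [V n].  A continuous function
    with values -1 and 1 at these points that shows this pattern is therefore
    at distance at least 1 from [V n] ([best_approx_signed_wave]).  Such a
    function exists with modulus bounded by 1 and r-th differences bounded by a
    constant times [(tau n * |v|) ^+ r]: a product of powers of truncated
    cosines [max 0 (cos (2 * pi * tau n * x_i))] is supported in disjoint cells
    around the grid points, so its sign can be chosen freely in each cell
    ([fdiff_bounded_signed_wave], [oscillating_function]).  As [tau (4 * n)] is
    of order at most [1 / phi n], the functions [h n] constructed for
    [V (4 * n)] have r-th differences bounded by a constant times
    [min 1 (s / y n)] with [s = |v| ^+ r] and [y n = phi n ^+ r].

    The function sought is [\sum_k omega (y n_k) * h n_k] for rapidly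
    increasing n_k ([gliding_hump]).  Its r-th differences are
    [O(\sum_k omega (y n_k) * min 1 (s / y n_k))].  The terms with
    [y n_k <= s] are at most [omega s], those with [s <= y n_k] are at most
    [2 * omega s] because [omega t / t] is almost decreasing.  Both parts
    behave like geometric sums: in the first one the factors [omega (y n_k)]
    decrease rapidly, and in the second one the factors
    [omega (y n_k) / y n_k] can be made to double at each step, since
    [omega t / t] tends to infinity at 0.  So the total is [O(omega s)]
    ([two_regime_sum]).  On the other hand, subadditivity of the errors shows
    that at index n_k the error of the whole sum cannot be much smaller than
    that of its k-th term, because the later terms are tiny and the earlier
    ones form a smooth function ([best_approx_hump]).  Smooth functions need
    not be approximated well by the given processes, but a smooth function that
    is not would already be a counterexample. *)

(** * Iterated differences *)

Definition fdiff (R : realType) (T : zmodType) (v : T) (F : T -> R)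
    (x : T) : R :=
  F (x + v) - F x.

(** Pascal's rule.  The recursive form of the r-th difference is the one that
    supports inductions on the order. *)
Lemma fwd_diffE (R : realType) (d r : nat) (v : 'rV[R]_d) F x :
  fwd_diff r v F x = iter r (fdiff v) F x.
Proof.
elim: r x => [|r IH] x.
  by rewrite /fwd_diff big_ord1 subnn expr0 bin0 !mul1r scale0r addr0.
rewrite iterS /fdiff -!IH /fwd_diff big_ord_recl /=.
under eq_bigr => j _ do rewrite /bump /= add1n subSS binS natrD mulrDr mulrDl.
rewrite big_split /= addrA addrC.
congr (_ + _).
  apply: eq_bigr => j _; congr (_ * F _).
  by rewrite -addrA -[j.+1]add1n natrD scalerDl scale1r.
rewrite big_ord_recr /= (@bin_small r r.+1)// mulr0 mul0r addr0.
rewrite big_ord_recl /= opprD -sumrN; congr (_ + _).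
  by rewrite !bin0 !subn0 exprS !mulr1 -mulrA mulN1r.
apply: eq_bigr => j _; rewrite /bump /= add1n -!mulNr; congr (_ * _ * _).
by rewrite -[in LHS](subnSK (ltn_ord j)) exprS mulN1r.
Qed.

(** Control of all differences up to order [r] by a geometric sequence, for one
    increment [v].  With [a] proportional to the length of [v] it replaces
    bounds on derivatives, and it is stable under products. *)
Definition fdiff_bounded (R : realType) (T : zmodType) (r : nat) (v : T)
    (A a : R) (F : T -> R) : Prop :=
  forall k x, (k <= r)%N -> `|iter k (fdiff v) F x| <= A * a ^+ k.

Lemma iter_fdiffD (R : realType) (T : zmodType) k (v : T) (F G : T -> R) x :
  iter k (fdiff v) (fun x => F x + G x) x =
    iter k (fdiff v) F x + iter k (fdiff v) G x.
Proof.
elim: k x => [//|k IH] x.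
by rewrite !iterS /fdiff !IH; ring.
Qed.

Lemma iter_fdiffZ (R : realType) (T : zmodType) k (v : T) (c : R)
    (F : T -> R) x :
  iter k (fdiff v) (fun x => c * F x) x = c * iter k (fdiff v) F x.
Proof.
elim: k x => [//|k IH] x.
by rewrite !iterS /fdiff !IH; ring.
Qed.

Lemma iter_fdiff_comp (R : realType) (T U : zmodType) (L : T -> U)
    (LD : forall x y, L (x + y) = L x + L y) k v (F : U -> R) x :
  iter k (fdiff v) (fun x => F (L x)) x = iter k (fdiff (L v)) F (L x).
Proof.
elim: k x => [//|k IH] x.
by rewrite !iterS /fdiff !IH LD.
Qed.

Lemma iter_fdiff_shift (R : realType) (T : zmodType) k (v : T)
    (F : T -> R) w x :
  iter k (fdiff v) (fun x => F (x + w)) x = iter k (fdiff v) F (x + w).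
Proof.
elim: k x => [//|k IH] x.
by rewrite !iterS /fdiff !IH addrAC.
Qed.

Lemma iter_fdiff_local (R : realType) (T : zmodType) k (v : T)
    (F G : T -> R) x :
  (forall j, (j <= k)%N -> F (x + v *+ j) = G (x + v *+ j)) ->
  iter k (fdiff v) F x = iter k (fdiff v) G x.
Proof.
elim: k x => [|k IH] x FG; first by have := FG 0%N isT; rewrite mulr0n addr0.
rewrite !iterS /fdiff; congr (_ - _); apply: IH => j jk.
  by rewrite -addrA -mulrS; exact: FG.
by apply: FG; exact: leqW.
Qed.

Lemma iter_fdiff_norm (R : realType) (T : zmodType) k (v : T) (F : T -> R) M x :
  (forall x, `|F x| <= M) -> `|iter k (fdiff v) F x| <= M * 2 ^+ k.
Proof.
move=> FM; elim: k x => [|k IH] x; first by rewrite expr0 mulr1.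
rewrite iterS /fdiff (le_trans (ler_normB _ _))//.
by rewrite exprS mulrCA mulr_natl mulr2n lerD.
Qed.

(** The Leibniz rule.  By induction on the order: the difference of the product
    is [F (x + v)] times the difference of [G] plus the difference of [F] times
    [G x], and the differences of [F] and [G] satisfy bounds of the same kind
    with [A * a] and [B * b] in place of [A] and [B]. *)
Lemma fdiff_boundedM (R : realType) (T : zmodType) r (v : T) (A a B b : R)
    (F G : T -> R) :
  0 <= A -> 0 <= B -> 0 <= a -> 0 <= b ->
  fdiff_bounded r v A a F -> fdiff_bounded r v B b G ->
  fdiff_bounded r v (A * B) (a + b) (fun x => F x * G x).
Proof.
move=> + + a0 b0; move=> A0 B0 Fr Gr k x kr.
have {}Fr : fdiff_bounded k v A a F.
  by move=> j y jk; apply: Fr; exact: leq_trans kr.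
have {}Gr : fdiff_bounded k v B b G.
  by move=> j y jk; apply: Gr; exact: leq_trans kr.
elim: k A B A0 B0 F G Fr Gr x {kr} => [|k IH] A B A0 B0 F G Fr Gr x.
  rewrite expr0 mulr1 normrM ler_pM//.
    by have := Fr 0%N x isT; rewrite expr0 mulr1.
  by have := Gr 0%N x isT; rewrite expr0 mulr1.
rewrite iterSr.
have -> : fdiff v (fun x => F x * G x)
  = fun x => F (x + v) * fdiff v G x + fdiff v F x * G x.
  by apply/funext => y; rewrite /fdiff; ring.
rewrite iter_fdiffD (le_trans (ler_normD _ _))//.
have -> : A * B * (a + b) ^+ k.+1
  = A * (B * b) * (a + b) ^+ k + A * a * B * (a + b) ^+ k by rewrite exprS; ring.
apply: lerD; apply: IH => //; try exact: mulr_ge0.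
- by move=> j y jk; rewrite iter_fdiff_shift; apply: Fr; exact: leqW.
- by move=> j y jk; rewrite -iterSr -mulrA -exprS; exact: Gr.
- by move=> j y jk; rewrite -iterSr -mulrA -exprS; exact: Fr.
- by move=> j y jk; apply: Gr; exact: leqW.
Qed.

Lemma fdiff_bounded_prod (R : realType) (T : zmodType) r (v : T) (a : R)
    (d : nat) (F : 'I_d -> T -> R) : 0 <= a -> (forall i, fdiff_bounded r v 1 a (F i)) ->
  fdiff_bounded r v 1 (d%:R * a) (fun x => \prod_(i < d) F i x).
Proof.
move=> a0; elim: d F => [|d IH] F Fr.
  move=> k x kr; rewrite mul0r.
  have -> : (fun x => \prod_(i < 0) F i x) = (fun _ : T => (1 : R)).
    by apply/funext => y; rewrite big_ord0.
  case: k {kr} => [|k]; first by rewrite normr1 expr0 mulr1.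
  have d0 y : iter k.+1 (fdiff v) (fun _ : T => (1 : R)) y = 0.
    elim: k y => [|k IHk] y; first by rewrite /= /fdiff subrr.
    by rewrite iterS /fdiff !IHk subrr.
  by rewrite d0 normr0 mulr_ge0// exprn_ge0.
have -> : (fun x => \prod_(i < d.+1) F i x)
   = (fun x => (\prod_(i < d) F (lift ord0 i) x) * F ord0 x).
  by apply/funext => y; rewrite big_ord_recl mulrC.
have -> : d.+1%:R * a = d%:R * a + a by rewrite -[d.+1]addn1 natrD mulrDl mul1r.
rewrite -[X in fdiff_bounded _ _ X _ _]mulr1.
by apply: fdiff_boundedM => //; [exact: mulr_ge0|apply: IH].
Qed.

Lemma is_derive_iter_fdiff (R : realType) k (v : R) (f df : R -> R) :
  (forall x : R, is_derive x 1 f (df x)) ->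
  forall x : R, is_derive x 1 (iter k (fdiff v) f) (iter k (fdiff v) df x).
Proof.
move=> fdf; elim: k => [//|k IH] x; rewrite !iterS.
have -> : fdiff v (iter k (fdiff v) f) =
   (iter k (fdiff v) f \o (fun y => y + v)) - iter k (fdiff v) f by [].
apply: is_deriveB.
rewrite -[X in is_derive _ _ _ X]mulr1.
apply: is_derive1_comp.
rewrite -[X in is_derive _ _ _ X]addr0.
exact: is_deriveD.
Qed.

(** The difference of order [k + 1] is the increment of the k-th difference of
    [f], whose derivative is the k-th difference of [df]. *)
Lemma iter_fdiff_mvt (R : realType) k (v M : R) (f df : R -> R) :
  (forall x : R, is_derive x 1 f (df x)) ->
  (forall x, `|iter k (fdiff v) df x| <= M) ->
  forall x, `|iter k.+1 (fdiff v) f x| <= `|v| * M.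
Proof.
move=> fdf dfM x; rewrite iterS /fdiff.
set g := iter k (fdiff v) f; have gdg := is_derive_iter_fdiff k v fdf.
have cg a b : {within `[a, b], continuous g}.
  apply: continuous_subspaceT => y.
  apply/differentiable_continuous/derivable1_diffP.
  by have [] := gdg y.
have [v0|v0|<-] := ltgtP 0 v; last by rewrite addr0 subrr !normr0 mul0r.
- have xv : x < x + v by rewrite ltrDl.
  have [c _ ->] := MVT xv (fun y _ => gdg y) (cg _ _).
  by rewrite addrC addKr normrM mulrC ler_wpM2l.
- have xv : x + v < x by rewrite gtrDl.
  rewrite distrC; have [c _ ->] := MVT xv (fun y _ => gdg y) (cg _ _).
  by rewrite opprD addNKr normrM normrN mulrC ler_wpM2l.
Qed.

(** This covers the square [t * max 0 t] of the positive part at all points at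
    once, including the junction at 0. *)
Lemma is_derive_quadratic (R : realType) (f : R -> R) (x l : R) :
  (forall h, `|f (h + x) - f x - h * l| <= h ^+ 2) -> is_derive x 1 f l.
Proof.
move=> fl.
have H : h^-1 *: (f (h *: 1 + x) - f x) @[h --> (0 : R)^'] --> l.
  apply/cvgrPdist_le => e e0; near=> h.
  have h0 : h != 0 by near: h; exact: nbhs_dnbhs_neq.
  have -> : l - h^-1 *: (f (h *: 1 + x) - f x)
      = - h^-1 * (f (h + x) - f x - h * l).
    by rewrite /GRing.scale /= mulr1; field.
  rewrite normrM normrN normfV ler_pdivrMl ?normr_gt0// (le_trans (fl h))//.
  rewrite -(ger0_norm (sqr_ge0 h)) normrX expr2 ler_wpM2l//.
  near: h; apply: dnbhs0_le => //.
split; first by apply/cvg_ex; exists l.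
by apply: cvg_lim.
Unshelve. all: by end_near. Qed.

(** * A truncated cosine of given smoothness *)

Definition truncated_power (R : realType) (m : nat) (t : R) : R := Num.max 0 t ^+ m.

Lemma is_derive_truncated_power (R : realType) m (x : R) :
  is_derive x 1 (@truncated_power R m.+2) (m.+2%:R * truncated_power m.+1 x).
Proof.
have q : is_derive x 1 (fun t : R => t * Num.max 0 t) (2 * Num.max 0 x).
  apply: is_derive_quadratic => h.
  rewrite ler_norml !maxEle.
  by case: ifPn => [hx|/negP]; case: ifPn => [x0|/negP]; nra.
have -> : @truncated_power R m.+2 =
    (fun t : R => t ^+ m) * (fun t : R => t * Num.max 0 t).
  apply/funext => t; transitivity (t ^+ m * (t * Num.max 0 t)); last by [].
  rewrite /truncated_power.
  have [t0|t0] := leP 0 t; first by rewrite -addn2 exprD expr2.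
  by rewrite expr0n !mulr0.
have -> : m.+2%:R * truncated_power m.+1 x =
  x ^+ m *: (2 * Num.max 0 x) + (x * Num.max 0 x) *: (m%:R * x ^+ m.-1 *: 1).
  rewrite /truncated_power /GRing.scale /=.
  have [x0|x0] := leP 0 x.
    case: m => [|m]; first by rewrite expr0 expr1 mul0r !mul0r; ring.
    by rewrite -[m.+3]addn2 natrD !exprS /=; ring.
  by rewrite expr0n/= !(mulr0, mul0r, addr0).
have Hm : is_derive x 1 (fun t : R => t ^+ m) (m%:R * x ^+ m.-1 *: 1).
  have -> : (fun t : R => t ^+ m) = (id : R -> R) ^+ m.
    by apply/funext => t; rewrite exprfctE.
  exact: is_deriveX.
exact: is_deriveM.
Qed.

Definition cospow (R : realType) (m : nat) (t : R) : R := truncated_power m (cos t).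

Lemma is_derive_cospow (R : realType) m (x : R) :
  is_derive x 1 (@cospow R m.+2) (m.+2%:R * (cospow m.+1 x * - sin x)).
Proof.
rewrite mulrA; apply: (@is_derive1_comp _ (@truncated_power R m.+2) (@cos R)).
exact: is_derive_truncated_power.
Qed.

Lemma dist_max0_le (R : realType) (a b : R) :
  `|Num.max 0 a - Num.max 0 b| <= `|a - b|.
Proof.
have h1 := ler_norm (a - b); have h2 := ler_norm (b - a); rewrite distrC in h2.
by rewrite ler_norml; have [a0|a0] := leP 0 a; have [b0|b0] := leP 0 b;
  apply/andP; split; lra.
Qed.

Lemma cospow_ge0 (R : realType) m (x : R) : 0 <= cospow m x.
Proof. by rewrite exprn_ge0// le_max lexx. Qed.

Lemma cospow_le1 (R : realType) m (x : R) : cospow m x <= 1.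
Proof. by rewrite exprn_ile1// ?le_max ?lexx// ge_max ler01 cos_le1. Qed.

Lemma iter_fdiff_sin_cos (R : realType) k (v : R) :
  (forall x, `|iter k (fdiff v) (@sin R) x| <= `|v| ^+ k) /\
  (forall x, `|iter k (fdiff v) (@cos R) x| <= `|v| ^+ k).
Proof.
elim: k => [|k [IHs IHc]].
  by split => x; rewrite expr0 /= ?sin_max ?cos_max.
split => x; rewrite exprS.
  by apply: (@iter_fdiff_mvt _ _ _ _ (@sin R) (@cos R)).
apply: (@iter_fdiff_mvt _ _ _ _ (@cos R) (fun x => -1 * sin x)).
  by move=> y; rewrite mulN1r; exact: is_derive_cos.
by move=> y; rewrite iter_fdiffZ mulN1r normrN.
Qed.

Lemma fdiff_bounded_Nsin (R : realType) k (v : R) :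
  fdiff_bounded k v 1 `|v| (fun x : R => - sin x).
Proof.
move=> j x _; have -> : (fun x : R => - sin x) = (fun x => -1 * sin x).
  by apply/funext => y; rewrite mulN1r.
rewrite iter_fdiffZ mulN1r normrN mul1r.
by have [+ _] := iter_fdiff_sin_cos j v; exact.
Qed.

(** The derivative of the power [m + 1] of [max 0 (cos t)] is
    [- (m + 1) * sin t] times the power [m], so each order of differences costs
    one power; the last power is only Lipschitz, which suffices for the last
    difference. *)
Lemma fdiff_bounded_cospow (R : realType) k m : (k <= m)%N ->
  exists2 K : R, 0 <= K &
    forall v : R, fdiff_bounded k v 1 (K * `|v|) (cospow m).
Proof.
elim: k m => [|k IH] m km.
  exists 0 => // v [|//] x _.
  by rewrite expr0 mulr1 ger0_norm ?cospow_ge0 ?cospow_le1.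
have [K1 K10 H1] := IH m (ltnW km).
have [K2 K20 H2] : exists2 K : R, 0 <= K &
    forall v x : R, `|iter k.+1 (fdiff v) (cospow m) x| <= (K * `|v|) ^+ k.+1.
  case: m km {H1} => [//|[|m]] km.
    move: km; rewrite ltnS leqn0 => /eqP ->; exists 1 => // v x.
    have [_ /(_ x)] := iter_fdiff_sin_cos 1 v.
    rewrite mul1r !expr1 /= /fdiff /cospow /truncated_power !expr1; apply: le_trans.
    exact: dist_max0_le.
  have [K K0 HK] := IH m.+1 km.
  exists (m.+2%:R * (K + 1)) => [|v x]; first by rewrite mulr_ge0// addr_ge0.
  apply: (@le_trans _ _ (`|v| * (m.+2%:R * (K * `|v| + `|v|) ^+ k))).
    apply: (iter_fdiff_mvt (df := fun x => m.+2%:R * (cospow m.+1 x * - sin x))).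
      exact: is_derive_cospow.
    move=> y; rewrite iter_fdiffZ normrM ger0_norm// ler_wpM2l//.
    have := fdiff_boundedM ler01 ler01 (mulr_ge0 K0 (normr_ge0 v)) (normr_ge0 v)
      (HK v) (@fdiff_bounded_Nsin R k v) y (leqnn k).
    by rewrite !mul1r.
  have -> : K * `|v| + `|v| = (K + 1) * `|v| by ring.
  rewrite !exprMn !exprS.
  have -> : `|v| * (m.+2%:R * ((K + 1) ^+ k * `|v| ^+ k)) =
    m.+2%:R * (K + 1) ^+ k * (`|v| * `|v| ^+ k) by ring.
  rewrite ler_wpM2r// ?mulr_ge0//.
  have -> : m.+2%:R * m.+2%:R ^+ k * ((K + 1) * (K + 1) ^+ k) =
    (m.+2%:R * (K + 1) ^+ k) * (m.+2%:R ^+ k * (K + 1)) by ring.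
  rewrite ler_peMr// ?mulr_ge0// ?exprn_ge0 ?addr_ge0//.
  by rewrite mulr_ege1// ?exprn_ege1 ?ler1n ?lerDr.
exists (K1 + K2) => [|v j x]; first exact: addr_ge0.
rewrite mul1r leq_eqVlt => /predU1P[->|jk].
  rewrite (le_trans (H2 _ _))// lerXn2r ?nnegrE ?mulr_ge0 ?addr_ge0//.
  by rewrite ler_wpM2r// lerDr.
rewrite (le_trans (H1 v _ _ _))// mul1r lerXn2r ?nnegrE ?mulr_ge0 ?addr_ge0//.
by rewrite ler_wpM2r// lerDl.
Qed.

(** * Bounded oscillations with prescribed signs on the grid *)

Lemma periodicz (U V : zmodType) (f : U -> V) (p : U) (m : int) (a : U) :
  periodic f p -> f (a + p *~ m) = f a.
Proof.
move=> fp; case: m => n; first exact: periodicn.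
by rewrite NegzE mulrNz -[in RHS](subrK (p *~ n.+1) a) -pmulrn periodicn.
Qed.

Definition nearest_int (R : realType) (t : R) : int := Num.floor (t + 2^-1).

(** By periodicity only the signed distance [u] to the nearest integer matters,
    and [cos (2 * pi * u)] is nonpositive for [1/4 <= |u| <= 1/2]. *)
Lemma cospow_nearest (R : realType) m (t : R) : (0 < m)%N ->
  cospow m (pi *+ 2 * t) != 0 -> `|t - (nearest_int t)%:~R| < 4^-1.
Proof.
move=> m0; set n := nearest_int t; set u := t - n%:~R.
have /andP[] := floor_itv (t + 2^-1); rewrite -/(nearest_int t) -/n intrD1 => nt tn.
have {nt tn} u2 : `|u| <= 2^-1 by rewrite /u ler_norml; apply/andP; split; lra.
have -> : pi *+ 2 * t = pi *+ 2 * u + (pi *+ 2) *~ n.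
  by rewrite -mulrzr -mulrDr /u subrK.
rewrite /cospow periodicz; last exact: cosD2pi.
apply: contraNT; rewrite -leNgt => u4.
suff cu : cos (pi *+ 2 * u) <= cos (pi / 2).
  rewrite cos_pihalf in cu.
  by rewrite /truncated_power (max_idPl cu) expr0n gtn_eqF.
have p0 := pi_gt0 R.
have pi2 : 0 <= (pi : R) *+ 2 by rewrite mulrn_wge0// ltW.
rewrite -cos_norm normrM (ger0_norm pi2).
move: u2 u4; set w := `|u| => u2 u4.
have h1 : pi *+ 2 * w \in `[0, pi] by rewrite in_itv/=; apply/andP; split; nra.
have h2 : (pi : R) / 2 \in `[0, pi] by rewrite in_itv/=; apply/andP; split; nra.
rewrite leNgt ltr_cos// -leNgt; nra.
Qed.

(** Points within 1/4 of distinct integers are more than 1/2 apart. *)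
Lemma nearest_int_close (R : realType) (s t : R) :
  `|s - (nearest_int s)%:~R| < 4^-1 -> `|t - (nearest_int t)%:~R| < 4^-1 ->
  `|s - t| <= 4^-1 -> nearest_int s = nearest_int t.
Proof.
rewrite !ltr_norml !ler_norml => /andP[s1 s2] /andP[t1 t2] /andP[st ts].
move: s1 s2 t1 t2; set a := nearest_int s; set b := nearest_int t => s1 s2 t1 t2.
apply/eqP; rewrite eq_le -!ltzD1 -!(ltr_int R) !intrD1.
by apply/andP; split; lra.
Qed.

Lemma nearest_int_nat (R : realType) (n : nat) : nearest_int (n%:R : R) = n%:Z.
Proof.
apply/eqP; rewrite floor_eq intrD1 -pmulrn; apply/andP; split; lra.
Qed.

Definition wave (R : realType) (d r : nat) (N : R) (x : 'rV[R]_d) : R :=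
  \prod_(i < d) cospow r (pi *+ 2 * N * x ord0 i).

Lemma wave_ge0 (R : realType) (d r : nat) (N : R) (x : 'rV[R]_d) :
  0 <= wave r N x.
Proof. by apply: prodr_ge0 => i _; exact: cospow_ge0. Qed.

Lemma wave_le1 (R : realType) (d r : nat) (N : R) (x : 'rV[R]_d) :
  wave r N x <= 1.
Proof. by apply: prodr_ile1 => i; rewrite cospow_ge0 cospow_le1. Qed.

Lemma fdiff_boundedW (R : realType) (T : zmodType) r (v : T) (A a b : R)
    (F : T -> R) :
  0 <= A -> 0 <= a -> a <= b -> fdiff_bounded r v A a F -> fdiff_bounded r v A b F.
Proof.
move=> A0 a0 ab Fa k x kr; rewrite (le_trans (Fa _ _ kr))// ler_wpM2l//.
by rewrite lerXn2r ?nnegrE// (le_trans a0).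
Qed.

Lemma fdiff_bounded_wave (R : realType) (d r : nat) :
  exists2 K : R, 0 <= K & forall (N : R) (v : 'rV[R]_d) (e : R),
    0 <= N -> 0 <= e -> (forall i, `|v ord0 i| <= e) ->
    fdiff_bounded r v 1 (K * (N * e)) (wave r N).
Proof.
have [K K0 HK] := @fdiff_bounded_cospow R r r (leqnn r).
have p0 := pi_ge0 R.
exists (d%:R * (K * (pi *+ 2))) => [|N v e N0 e0 ve].
  by rewrite !mulr_ge0// mulrn_wge0.
rewrite -[_ * (K * _) * _]mulrA; apply: fdiff_bounded_prod => [|i].
  by rewrite !mulr_ge0// mulrn_wge0.
apply: (@fdiff_boundedW _ _ _ _ _ (K * `|pi *+ 2 * N * v ord0 i|)) => //.
- exact: mulr_ge0.
- have pN : 0 <= pi *+ 2 * N by rewrite mulr_ge0// mulrn_wge0.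
  have -> : K * (pi *+ 2) * (N * e) = K * (pi *+ 2 * N * e) by ring.
  by rewrite ler_wpM2l// normrM (ger0_norm pN) ler_wpM2l.
- move=> k x kr.
  rewrite (@iter_fdiff_comp R _ _ (fun x : 'rV[R]_d => pi *+ 2 * N * x ord0 i)).
    exact: HK.
  by move=> y z; rewrite mxE mulrDr.
Qed.

(** The sign is a function of the cell of the scaled lattice to which [x]
    belongs. *)
Definition signed_wave (R : realType) (d r : nat) (sg : ('I_d -> int) -> R)
    (N : R) (x : 'rV[R]_d) : R :=
  sg (fun i => nearest_int (N * x ord0 i)) * wave r N x.

Lemma signed_wave_le1 (R : realType) (d r : nat) (sg : ('I_d -> int) -> R)
    (N : R) (x : 'rV[R]_d) :
  (forall z, `|sg z| <= 1) -> `|signed_wave r sg N x| <= 1.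
Proof.
by move=> sg1; rewrite normrM mulr_ile1// (ger0_norm (wave_ge0 _ _ _)) wave_le1.
Qed.

Lemma wave_nearest (R : realType) (d r : nat) (N : R) (x : 'rV[R]_d) i :
  (0 < r)%N -> wave r N x != 0 ->
  `|N * x ord0 i - (nearest_int (N * x ord0 i))%:~R| < 4^-1.
Proof.
move=> r0 /prodf_neq0 /(_ i isT); rewrite -mulrA; exact: cospow_nearest.
Qed.

(** If the points used by the difference are so close together that they meet
    the support in a single cell, the sign is a constant factor and the bound
    for [wave] applies.  Otherwise [N * e] is bounded below, and the trivial
    bound by [2 ^+ k] is good enough. *)
Lemma fdiff_bounded_signed_wave (R : realType) (d r : nat) : (0 < r)%N ->
  exists2 B : R, 0 <= B &
    forall (sg : ('I_d -> int) -> R) (N : R) (v : 'rV[R]_d) (e : R),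
    (forall z, `|sg z| <= 1) -> 0 <= N -> 0 <= e ->
    (forall i, `|v ord0 i| <= e) ->
    fdiff_bounded r v 1 (B * (N * e)) (signed_wave r sg N).
Proof.
move=> r0; have [K K0 HK] := @fdiff_bounded_wave R d r.
exists (K + 8 * r%:R) => [|sg N v e sg1 N0 e0 ve k x kr].
  by rewrite addr_ge0// mulr_ge0.
have Ne0 := mulr_ge0 N0 e0; have r1 : (1 : R) <= r%:R by rewrite ler1n.
rewrite mul1r; have [small|large] := leP (r%:R * (N * e)) 4^-1; last first.
  apply: le_trans (_ : 1 * 2 ^+ k <= _).
    by apply: iter_fdiff_norm => y; exact: signed_wave_le1.
  rewrite mul1r lerXn2r ?nnegrE ?mulr_ge0// ?addr_ge0 ?mulr_ge0//.
  rewrite mulrDl; have := mulr_ge0 K0 Ne0; lra.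
have [s s1 hs] : exists2 s : R, `|s| <= 1 & forall j, (j <= k)%N ->
    signed_wave r sg N (x + v *+ j) = s * wave r N (x + v *+ j).
  have [[j0 [j0k w0]]|nz] :=
      pselect (exists j, (j <= k)%N /\ wave r N (x + v *+ j) != 0).
    exists (sg (fun i => nearest_int (N * (x + v *+ j0) ord0 i))) => // j jk.
    rewrite /signed_wave; have [->|w1] := eqVneq (wave r N (x + v *+ j)) 0.
      by rewrite !mulr0.
    congr (sg _ * _); apply/funext => i.
    apply: nearest_int_close; [exact: wave_nearest r0 w1|exact: wave_nearest r0 w0|].
    apply: le_trans small.
    have -> : N * (x + v *+ j) ord0 i - N * (x + v *+ j0) ord0 i
      = (j%:R - j0%:R) * (N * v ord0 i).
      rewrite -mulrBr !mxE !mulmxnE opprD addrACA subrr add0r.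
      by rewrite -!(mulr_natl (v ord0 i)) -mulrBl mulrCA.
    rewrite normrM; apply: ler_pM => //; last first.
      by rewrite normrM (ger0_norm N0) ler_wpM2l.
    have jr : (j%:R : R) <= r%:R by rewrite ler_nat (leq_trans jk).
    have j0r : (j0%:R : R) <= r%:R by rewrite ler_nat (leq_trans j0k).
    have j_ge0 : (0 : R) <= j%:R by [].
    have j0_ge0 : (0 : R) <= j0%:R by [].
    by rewrite ler_norml; apply/andP; split; lra.
  exists 0 => [|j jk]; first by rewrite normr0.
  rewrite mul0r /signed_wave; have [->|w1] := eqVneq (wave r N (x + v *+ j)) 0.
    by rewrite mulr0.
  by case: nz; exists j.
have -> : iter k (fdiff v) (signed_wave r sg N) x
    = iter k (fdiff v) (fun y => s * wave r N y) x by exact: iter_fdiff_local.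
rewrite iter_fdiffZ normrM -[leRHS]mul1r ler_pM//.
rewrite (le_trans (HK N v e N0 e0 ve k x kr))// mul1r lerXn2r ?nnegrE ?mulr_ge0//.
  by rewrite addr_ge0// mulr_ge0.
by rewrite ler_wpM2r// lerDl mulr_ge0.
Qed.

Lemma lipschitz_Ccube (R : realType) (d : nat) (F : 'rV[R]_d -> R) (L : R) :
  0 <= L ->
  (forall (v x : 'rV[R]_d) (e : R), 0 <= e -> (forall i, `|v ord0 i| <= e) ->
     `|F (x + v) - F x| <= L * e) ->
  Ccube F.
Proof.
move=> L0 FL; apply: continuous_subspaceT => x.
have Fx : Filter (nbhs x) := nbhs_filter x.
apply/cvgrPdist_le => e e0.
have d0 : 0 < e / (L + 1) by rewrite divr_gt0// ltr_wpDl.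
near=> y.
have yx : forall i, `|(y - x) ord0 i| <= e / (L + 1).
  move=> i; have xy : ball x (e / (L + 1)) y.
    by near: y; apply: (@nbhsx_ballx _ _ x _ d0).
  have [_ xym] := xy; have := xym ord0 i; rewrite /ball /= distrC !mxE; exact: ltW.
rewrite distrC; have := FL _ x _ (ltW d0) yx.
rewrite (addrC x) subrK => /le_trans; apply.
by rewrite mulrA ler_pdivrMr ?ltr_wpDl// [L * e]mulrC ler_wpM2l ?ltW// ltrDl.
Unshelve. all: by end_near. Qed.

Definition grid_pt (R : realType) (d t : nat) (j : {ffun 'I_d -> 'I_t}) :
    'rV[R]_d :=
  \row_i ((j i)%:R / t%:R).

Lemma grid_grid_pt (R : realType) (d t : nat) (j : {ffun 'I_d -> 'I_t}) :
  grid R d t (grid_pt R j).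
Proof. by move=> i; exists (j i); rewrite ?mxE// ltnW. Qed.

Lemma grid_pt_inj (R : realType) (d t : nat) : injective (@grid_pt R d t).
Proof.
move=> j k jk; apply/ffunP => i; apply/val_inj.
have := congr1 (fun x : 'rV[R]_d => x ord0 i) jk; rewrite !mxE.
have t0 : (t%:R : R) != 0 by rewrite pnatr_eq0 -lt0n (leq_trans _ (ltn_ord (j i))).
by move=> /(mulIf (invr_neq0 t0))/eqP; rewrite eqr_nat => /eqP.
Qed.

(** The points [grid_pt j] with [j] in [{0, ..., t - 1}^d] are [t ^ d] distinct
    points of the grid, too many to be shattered. *)
Lemma VCdim_lt_signs (R : realType) (d t : nat) (W : set ('rV[R]_d -> R)) :
  (VCdim (restr_grid t W) < ((t ^ d)%:R : R)%:E)%E ->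
  exists2 s : {ffun 'I_d -> 'I_t} -> R, (forall j, s j = -1 \/ s j = 1) &
    forall g, W g -> exists j, heaviside (g (grid_pt R j)) <> heaviside (s j).
Proof.
move=> VC; pose T := {ffun 'I_d -> 'I_t}.
pose x (k : 'I_#|T|) : grid R d t := SigSub (mem_set (grid_grid_pt R (enum_val k))).
have : ~ shatters (restr_grid t W) x.
  move=> sh; move: VC; apply/negP; rewrite -leNgt.
  apply: ereal_sup_ubound; exists #|T|.
    exists x => // k1 k2 /(congr1 val) /= /grid_pt_inj; exact: enum_val_inj.
  by rewrite card_ffun !card_ord.
move=> /existsNP[s /not_implyP[s1 /forall2NP sV]].
exists (fun j => s (enum_rank j)) => [j|g Wg]; first exact: s1.
have [/(_ _)|/existsNP[k]] := sV (fun y => g (val y)).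
  by case; exists g.
by exists (enum_val k); rewrite enum_valK.
Qed.

(** A wrong sign puts [x] and [s] on different sides of 0.  The extreme case is
    [s = -1] and [x = 0], where 0 counts as positive and the distance is 1. *)
Lemma heaviside_dist (R : realType) (s x : R) : s = -1 \/ s = 1 ->
  heaviside x <> heaviside s -> 1 <= `|s - x|.
Proof.
rewrite /heaviside => -[->|->].
  rewrite ltrN10; case: ltP => // x0 _.
  by rewrite distrC opprK ger0_norm ?addr_ge0// lerDr.
by rewrite ltr10; case: ltP => // x0 _; rewrite gtr0_norm ?subr_gt0 ?lerDl; lra.
Qed.

Lemma sup_ge0 (R : realType) (A : set R) :
  (forall x, A x -> 0 <= x) -> 0 <= sup A.
Proof.
move=> A0; have [[[x Ax] Aub]|/sup_out ->//] := pselect (has_sup A).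
exact: le_trans (A0 x Ax) (ub_le_sup Aub Ax).
Qed.

Lemma supnorm_le (R : realType) (T : Type) (A : set T) (f : T -> R) (M : R) :
  0 <= M -> (forall x, A x -> `|f x| <= M) -> supnorm A f <= M.
Proof.
move=> M0 fM; rewrite /supnorm; have [->|/set0P[x Ax]] := eqVneq A set0.
  by rewrite image_set0 sup0.
apply: ge_sup; first by exists `|f x|, x.
by move=> _ [y Ay <-]; exact: fM.
Qed.

Lemma supnorm_ge0 (R : realType) (T : Type) (A : set T) (f : T -> R) :
  0 <= supnorm A f.
Proof. by apply: sup_ge0 => _ [y _ <-]. Qed.

(** The pattern [s] is indexed by [{0, ..., t - 1}^d] only, while [signed_wave]
    expects a sign for every lattice point. *)
Definition sign_extension (R : realType) (d t : nat)
    (s : {ffun 'I_d -> 'I_t} -> R) (z : 'I_d -> int) : R :=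
  if [pick j : {ffun 'I_d -> 'I_t} | [forall i, z i == (j i)%:Z]] is Some j
  then s j else 1.

Lemma signed_wave_grid (R : realType) (d t r : nat)
    (s : {ffun 'I_d -> 'I_t} -> R) j :
  (0 < t)%N -> signed_wave r (sign_extension s) t%:R (grid_pt R j) = s j.
Proof.
move=> t0; have tj i : t%:R * grid_pt R j ord0 i = (j i)%:R.
  by rewrite mxE mulrC divfK// pnatr_eq0 -lt0n.
rewrite /signed_wave; have -> : wave r t%:R (grid_pt R j) = 1.
  apply: big1 => i _; rewrite -mulrA tj -[_ * _]add0r mulr_natr /cospow.
  by rewrite (periodicn (@cosD2pi R)) cos0 /truncated_power max_r// expr1n.
rewrite mulr1 /sign_extension; case: pickP => [k /forallP zk|/(_ j)/forallP[]].
  congr s; apply/ffunP => i; apply/val_inj; have /eqP := zk i.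
  by rewrite tj nearest_int_nat => -[].
by move=> i; rewrite tj nearest_int_nat.
Qed.

(** At the grid points, the function is a pattern of values -1 and 1 that no
    element of [W] reproduces, so every element of [W] has the wrong sign at
    some grid point. *)
Lemma best_approx_signed_wave (R : realType) (d t r : nat)
    (W : set ('rV[R]_d -> R)) :
  (0 < t)%N -> (forall g, W g -> [bounded g x | x in cube R d]) ->
  (VCdim (restr_grid t W) < ((t ^ d)%:R : R)%:E)%E ->
  exists2 sg : ('I_d -> int) -> R, forall z, `|sg z| <= 1 &
    (1 <= best_approx W (signed_wave r sg t%:R))%E.
Proof.
move=> t0 Wb /VCdim_lt_signs[s s1 sW].
have sg1 z : `|sign_extension s z| <= 1.
  rewrite /sign_extension; case: pickP => [j _|_]; last by rewrite normr1.
  by case: (s1 j) => ->; rewrite ?normrN normr1.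
exists (sign_extension s) => //.
apply: le_ereal_inf_tmp => _ [g Wg <-]; rewrite lee_fin.
have [j gs] := sW g Wg; apply: le_trans (heaviside_dist (s1 j) gs) _.
apply: ub_le_sup; last first.
  exists (grid_pt R j); last by rewrite /= signed_wave_grid.
  move=> i; rewrite mxE divr_ge0//= ler_pdivrMr ?ltr0n// mul1r ler_nat.
  exact: ltnW.
have [M [_ gM]] := Wb g Wg; exists (1 + (M + 1)) => _ [x cx <-] /=.
rewrite (le_trans (ler_normB _ _))// lerD ?signed_wave_le1//.
by apply: gM => //; rewrite ltrDl.
Qed.

Lemma norm_coord_le_eucl_norm (R : realType) (d : nat) (v : 'rV[R]_d) i :
  `|v ord0 i| <= eucl_norm v.
Proof.
rewrite -sqrtr_sqr ler_wsqrtr// (bigD1 i)//= lerDl sumr_ge0// => j _.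
exact: sqr_ge0.
Qed.

(** The bump functions of the construction: continuity is the case of first
    differences. *)
Lemma oscillating_function (R : realType) (d r : nat) : (0 < r)%N ->
  exists2 A : R, 0 <= A & forall (t : nat) (W : set ('rV[R]_d -> R)),
    (0 < t)%N -> (forall g, W g -> [bounded g x | x in cube R d]) ->
    (VCdim (restr_grid t W) < ((t ^ d)%:R : R)%:E)%E ->
    exists h : 'rV[R]_d -> R,
      [/\ Ccube h, forall x, `|h x| <= 1, (1 <= best_approx W h)%E &
          forall e v x, 0 <= e -> eucl_norm v <= e ->
            `|fwd_diff r v h x| <= A * (t%:R * e) ^+ r].
Proof.
move=> r0; have [B B0 HB] := @fdiff_bounded_signed_wave R d r r0.
exists (B ^+ r) => [|t W t0 Wb VC]; first exact: exprn_ge0.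
have [sg sg1 Wsg] := best_approx_signed_wave r t0 Wb VC.
exists (signed_wave r sg t%:R); split => //.
- apply: (@lipschitz_Ccube _ _ _ (B * t%:R)); first exact: mulr_ge0.
  move=> v x e e0 ve; have := HB sg t%:R v e sg1 (ler0n _ _) e0 ve 1%N x r0.
  by rewrite /= mul1r expr1 mulrA.
- by move=> x; exact: signed_wave_le1.
- move=> e v x e0 ve; rewrite fwd_diffE -exprMn.
  have := HB sg t%:R v e sg1 (ler0n _ _) e0 _ r x (leqnn r); rewrite mul1r; apply.
  by move=> i; exact: le_trans (norm_coord_le_eucl_norm v i) ve.
Qed.

(** * Moduli of smoothness and lacunary sums *)

(** Subadditivity bounds [omega y] by [m * omega s] for the least integer [m]
    above [y / s], and [m <= 2 * (y / s)]. *)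
Lemma abstract_modulus_le_ratio (R : realType) (omega : R -> R) (s y : R) :
  abstract_modulus omega -> 0 < s -> s <= y ->
  omega y / y * s <= 2 * omega s.
Proof.
move=> om s0 sy; have y0 : 0 < y by exact: lt_le_trans sy.
have om_nat m : omega (m%:R * s) <= m%:R * omega s.
  elim: m => [|m IH]; first by rewrite !mul0r (modulus_at0 om).
  case: m IH => [|m] IH; first by rewrite !mul1r.
  rewrite -[m.+2]addn1 natrD !mulrDl !mul1r.
  have ms : 0 < m.+1%:R * s by rewrite mulr_gt0.
  by have /andP[_ /le_trans] := modulus_subadditive om ms s0; apply; rewrite lerD2r.
have ys : 1 <= y / s by rewrite ler_pdivlMr// mul1r.
have /andP[tl tg] := truncn_itv (le_trans ler01 ys).
have os0 := modulus_gt0 om s0.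
have : omega y <= (Num.trunc (y / s)).+1%:R * omega s.
  apply: le_trans (om_nat _); apply: (modulus_increasing om (ltW y0)).
  by rewrite -ler_pdivrMr// ltW.
move=> oy; have {}oy : omega y <= 2 * (y / s) * omega s.
  apply: le_trans oy _; rewrite (ler_wpM2r (ltW os0))// -[_.+1%:R]natr1; lra.
rewrite mulrAC ler_pdivrMr//; apply: le_trans (ler_wpM2r (ltW s0) oy) _.
by rewrite le_eqVlt; apply/orP; left; apply/eqP; field; rewrite gt_eqF.
Qed.

Lemma abstract_modulus_near0 (R : realType) (omega : R -> R) (e : R) :
  abstract_modulus omega -> 0 < e -> \forall s \near 0^'+, omega s < e.
Proof.
move=> om e0; have /continuous_within_itvcyP[_] := modulus_continuous om.
rewrite (modulus_at0 om) => /cvgr_dist_lt /(_ e e0); apply: filterS => s.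
by rewrite sub0r normrN; exact/le_lt_trans/ler_norm.
Qed.

Lemma radial_modulus_le (R : realType) (d r : nat) (U : set 'rV[R]_d)
    f (delta M : R) :
  0 <= M ->
  (forall v x, eucl_norm v <= delta -> `|fwd_diff r v f x| <= M) ->
  `|radial_modulus U r f delta| <= M.
Proof.
move=> M0 fM; rewrite /radial_modulus ger0_norm; last first.
  by apply: sup_ge0 => _ [v _ <-]; exact: supnorm_ge0.
set A := [set v | _]; have [->|/set0P[v Av]] := eqVneq A set0.
  by rewrite image_set0 sup0.
apply: ge_sup.
  by exists (supnorm (closure (translatable U (r%:R *: v))) (fwd_diff r v f)), v.
by move=> _ [w Aw <-]; apply: supnorm_le => // x _; exact: fM.
Qed.

Lemma radial_modulus_bigO (R : realType) (d r : nat) (U : set 'rV[R]_d) f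
    (omega : R -> R) (C : R) : abstract_modulus omega -> 0 <= C ->
  (\forall delta \near 0^'+, forall v x, eucl_norm v <= delta ->
     `|fwd_diff r v f x| <= C * omega (delta ^+ r)) ->
  radial_modulus U r f =O_ (0^'+) (fun delta : R => omega (delta ^+ r)).
Proof.
move=> om C0 fC; apply/eqO_exP; exists (C + 1); first by rewrite ltr_wpDl.
have : \forall delta \near (0 : R)^'+, 0 < delta by exact: nbhs_right_gt.
apply: filterS2 fC => delta fC delta0.
have o0 : 0 <= omega (delta ^+ r) by apply: (modulus_ge0 om); rewrite exprn_ge0// ltW.
rewrite (ger0_norm o0); apply: le_trans (_ : C * omega (delta ^+ r) <= _).
  by apply: radial_modulus_le => //; exact: mulr_ge0.
by rewrite ler_wpM2r// lerDl.
Qed.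

(** The sequence [T] grows by at most [A] times both [a k] and
    [a k / y k * s].  As long as [s <= y k], the second bound is used, and the
    growing geometric sequence [a k / y k] makes the sum comparable to its last
    term; after that the first bound is used, and the decreasing sequence [a]
    makes the rest comparable to its first term.  The two alternatives of the
    invariant correspond to these two phases. *)
Lemma two_regime_sum (R : realType) (T a y : nat -> R) (A s w : R) :
  0 <= A -> 0 < s -> 0 <= w -> (forall k, 0 < y k) -> (forall k, 0 <= a k) ->
  T 0%N = 0 ->
  (forall k, T k.+1 <= T k + A * a k.+1) ->
  (forall k, T k.+1 <= T k + A * (a k.+1 / y k.+1 * s)) ->
  (forall k, 2 * a k.+1 <= a k) ->
  (forall k, 2 * (a k / y k) <= a k.+1 / y k.+1) ->
  (forall k, y k <= s -> a k <= w) ->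
  (forall k, s <= y k -> a k / y k * s <= 2 * w) ->
  forall k, T k <= 6 * A * w.
Proof.
move=> A0 s0 w0 y0 a0 T0 Ta Ty ha hy lo hi k.
have : (s <= y k /\ T k <= A * (2 * (a k / y k * s))) \/ T k <= A * (6 * w - a k).
  elim: k => [|k [[sy Tk]|Tk]].
  - rewrite T0; have [sy|/ltW ys] := leP s (y 0%N); [left; split => //|right].
      by rewrite !mulr_ge0// ?invr_ge0 ltW.
    by rewrite mulr_ge0//; have := lo _ ys; lra.
  - have [sy'|/ltW ys'] := leP s (y k.+1); [left; split => //|right].
      apply: le_trans (Ty k) _; apply: le_trans (lerD Tk (lexx _)) _.
      rewrite -mulrDr ler_wpM2l//.
      by have := ler_wpM2r (ltW s0) (hy k); lra.
    apply: le_trans (Ta k) _; apply: le_trans (lerD Tk (lexx _)) _.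
    rewrite -mulrDr ler_wpM2l//; have := hi _ sy; have := lo _ ys'; lra.
  - right; apply: le_trans (Ta k) _; apply: le_trans (lerD Tk (lexx _)) _.
    by rewrite -mulrDr ler_wpM2l//; have := ha k; lra.
have -> : 6 * A * w = A * (6 * w) by ring.
move=> [[sy Tk]|Tk]; apply: le_trans Tk _; rewrite ler_wpM2l//.
  by have := hi _ sy; lra.
by have := a0 k; lra.
Qed.

(** The intervals of centre [u k] and radius [b k] are nested. *)
Lemma nested_limit (R : realType) (u b : nat -> R) : (forall k, 0 <= b k) ->
  (forall k, `|u k.+1 - u k| + b k.+1 <= b k) ->
  exists L, forall k, `|L - u k| <= b k.
Proof.
move=> b0 ub; pose lo k := u k - b k; pose hi k := u k + b k.
have lohi j k : lo j <= hi k.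
  have lo_nd : {homo lo : m n / (m <= n)%N >-> m <= n}.
    apply: homo_leq => //; first by move=> ? ? ?; exact: le_trans.
    move=> n; have := ub n; have := ler_norm (u n - u n.+1).
    by rewrite distrC /lo; lra.
  have hi_ni : {homo hi : m n / (m <= n)%N >-> n <= m}.
    apply: homo_leq => //; first by move=> x z t h1 h2; exact: le_trans h2 h1.
    by move=> n; have := ub n; have := ler_norm (u n.+1 - u n); rewrite /hi; lra.
  apply: le_trans (lo_nd _ _ (leq_maxl j k)) _.
  apply: le_trans (hi_ni _ _ (leq_maxr j k)).
  by rewrite /lo /hi; have := b0 (maxn j k); lra.
exists (sup (range lo)) => k.
have h1 : lo k <= sup (range lo).
  by apply: ub_le_sup; [exists (hi 0%N) => _ [j _ <-]|exists k].
have h2 : sup (range lo) <= hi k.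
  by apply: ge_sup; [exists (lo 0%N), 0%N|move=> _ [j _ <-]].
by rewrite ler_norml; apply/andP; split; move: h1 h2; rewrite /lo /hi; lra.
Qed.

Lemma halving_small (R : realType) (a : nat -> R) (e : R) : 0 < e ->
  (forall k, 0 <= a k) -> (forall k, 2 * a k.+1 <= a k) -> exists k, a k <= e.
Proof.
move=> e0 a0 ha; have aN k : k%:R * a k <= a 0%N.
  apply: (@le_trans _ _ (2 ^+ k * a k)).
    by rewrite ler_wpM2r// -natrX ler_nat ltnW// ltn_expl.
  elim: k => [|k IH]; first by rewrite mul1r.
  by apply: le_trans IH; rewrite exprSr -mulrA ler_wpM2l// exprn_ge0.
pose k := (Num.trunc (a 0%N / e)).+1; exists k.
have /andP[_ kg] := truncn_itv (divr_ge0 (a0 0%N) (ltW e0)).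
rewrite ltr_pdivrMr// in kg.
have k0 : (0 : R) < k%:R by rewrite ltr0n.
rewrite -(ler_pM2l k0); exact: le_trans (aN k) (ltW kg).
Qed.

Lemma uniform_limit_Ccube (R : realType) (d : nat) (f : 'rV[R]_d -> R) :
  (forall e, 0 < e -> exists2 g, Ccube g & forall x, `|f x - g x| <= e) -> Ccube f.
Proof.
move=> fg x; have Fx : Filter (nbhs x) := nbhs_filter x.
apply/cvgrPdist_le => e e0; have e3 : 0 < e / 3 by rewrite divr_gt0.
have [g gc gf] := fg _ e3.
have /cvgrPdist_le/(_ _ e3) := gc x; apply: filterS => y gxy.
have -> : f x - f y = (f x - g x) + (g x - g y) - (f y - g y) by ring.
rewrite (le_trans (ler_normB _ _))//.
rewrite [leRHS](_ : e = e / 3 + e / 3 + e / 3); last by field.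
by rewrite lerD// (le_trans (ler_normD _ _))// lerD.
Qed.

(** The r-th difference is continuous for uniform convergence. *)
Lemma fwd_diff_limit (R : realType) (d r : nat) (v x : 'rV[R]_d)
    (f : 'rV[R]_d -> R) (M : R) :
  (forall e, 0 < e -> exists g, (forall x, `|f x - g x| <= e) /\
     `|fwd_diff r v g x| <= M) ->
  `|fwd_diff r v f x| <= M.
Proof.
move=> fg; apply/ler_addgt0Pr => e e0.
have e2 : 0 < e / 2 ^+ r by rewrite divr_gt0// exprn_gt0.
have [g [gf gM]] := fg _ e2.
have -> : f = (fun x => g x + (f x - g x)) by apply/funext => z; ring.
rewrite fwd_diffE iter_fdiffD -fwd_diffE (le_trans (ler_normD _ _))// lerD//.
by rewrite (le_trans (iter_fdiff_norm _ _ _ gf))// divfK// expf_neq0.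
Qed.

Lemma not_littleoPn (R : realType) (E : nat -> \bar R) (a : nat -> R) (e : R) :
  ~ not_littleo E a -> 0 < e ->
  \forall n \near \oo, 0 < a n -> (E n <= (e * a n)%:E)%E.
Proof.
move=> /negP; rewrite -leNgt => Ea e0.
have : (limn_esup (fun n => E n * (a n)^-1%:E) < e%:E)%E.
  by apply: le_lt_trans Ea _; rewrite lte_fin.
move=> /ereal_inf_lt[_ [W FW <-] We]; apply: filterS FW => n Wn an.
rewrite EFinM -lee_pdivrMr// (le_trans _ (ltW We))//.
by apply: ereal_sup_ubound; exists n.
Qed.

Lemma near_right_comp (R : realType) (T : Type) (F : set_system T)
    (FF : Filter F) (u : T -> R) (P : set R) :
  u x @[x --> F] --> (0 : R) -> (\forall x \near F, 0 < u x) ->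
  (\forall s \near 0^'+, P s) -> \forall x \near F, P (u x).
Proof.
move=> u0 upos P0.
have := u0 [set s | 0 < s -> P s] P0.
by apply: filterS2 upos => x ux; exact.
Qed.

Lemma near_right_expr (R : realType) (r : nat) (P : set R) : (0 < r)%N ->
  (\forall s \near 0^'+, P s) -> \forall s \near 0^'+, P (s ^+ r).
Proof.
move=> r0; apply: near_right_comp.
  have e0 : (0 : R) ^+ r = 0 by rewrite expr0n gtn_eqF.
  rewrite -[X in _ --> X]e0; apply: cvg_at_right_filter; exact: exprn_continuous.
have : \forall s \near (0 : R)^'+, 0 < s by exact: nbhs_right_gt.
by apply: filterS => s s0; exact: exprn_gt0.
Qed.

Lemma CcubeD (R : realType) (d : nat) (f g : 'rV[R]_d -> R) :
  Ccube f -> Ccube g -> Ccube (fun x => f x + g x).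
Proof. by move=> fc gc x; exact: cvgD (fc x) (gc x). Qed.

Lemma CcubeZ (R : realType) (d : nat) (c : R) (f : 'rV[R]_d -> R) :
  Ccube f -> Ccube (fun x => c * f x).
Proof. by move=> fc x; exact: cvgMr (fc x). Qed.

Lemma Ccube_cst (R : realType) (d : nat) (c : R) :
  Ccube (fun _ : 'rV[R]_d => c).
Proof. by move=> x; exact: cvg_cst. Qed.

Lemma fwd_diff0 (R : realType) (d r : nat) (v x : 'rV[R]_d) :
  fwd_diff r v (fun=> 0) x = 0.
Proof. by apply: big1 => i _; rewrite mulr0. Qed.

Lemma fwd_diffDZ (R : realType) (d r : nat) (v x : 'rV[R]_d) (c : R)
    (f g : 'rV[R]_d -> R) :
  fwd_diff r v (fun x => f x + c * g x) x =
    fwd_diff r v f x + c * fwd_diff r v g x.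
Proof. by rewrite !fwd_diffE iter_fdiffD iter_fdiffZ. Qed.

(** * The gliding hump *)

(** The bound that an r times differentiable function satisfies.  The finite
    partial sums of the construction stay in this class. *)
Definition smooth_of_order (R : realType) (d r : nat) (f : 'rV[R]_d -> R) :
    Prop :=
  Ccube f /\ exists2 C, 0 <= C & forall e v x, 0 <= e -> eucl_norm v <= e ->
    `|fwd_diff r v f x| <= C * e ^+ r.

Lemma smooth_of_order0 (R : realType) (d r : nat) :
  smooth_of_order r (fun _ : 'rV[R]_d => 0).
Proof.
split; first exact: Ccube_cst.
by exists 0 => // e v x _ _; rewrite mul0r fwd_diff0 normr0.
Qed.

Lemma smooth_of_orderDZ (R : realType) (d r : nat) (c : R)
    (f g : 'rV[R]_d -> R) : 0 <= c ->
  smooth_of_order r f -> smooth_of_order r g ->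
  smooth_of_order r (fun x => f x + c * g x).
Proof.
move=> c0 [fc [C C0 fd]] [gc [B B0 gd]]; split.
  by apply: CcubeD => //; exact: CcubeZ.
exists (C + c * B) => [|e v x e0 ve]; first by rewrite addr_ge0// mulr_ge0.
rewrite fwd_diffDZ (le_trans (ler_normD _ _))// mulrDl lerD ?fd//.
by rewrite normrM (ger0_norm c0) -mulrA ler_wpM2l// gd.
Qed.

(** As [omega] dominates the identity near 0, [delta ^+ r] is eventually below
    [omega (delta ^+ r)]. *)
Lemma smooth_of_order_bigO (R : realType) (d r : nat) (U : set 'rV[R]_d)
    (omega : R -> R) (f : 'rV[R]_d -> R) :
  (0 < r)%N -> abstract_modulus omega ->
  omega delta / delta @[delta --> 0^'+] --> +oo -> smooth_of_order r f ->
  radial_modulus U r f =O_ (0^'+) (fun delta : R => omega (delta ^+ r)).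
Proof.
move=> r0 om om_lim [fc [C C0 fd]].
apply: (@radial_modulus_bigO _ _ _ _ _ _ C om C0).
have s0 : \forall s \near (0 : R)^'+, 0 < s by exact: nbhs_right_gt.
have : \forall s \near (0 : R)^'+, s <= omega s.
  have /cvgryPge /(_ 1) := om_lim; apply: filterS2 s0 => s s0.
  by rewrite ler_pdivlMr// mul1r.
move=> /(near_right_expr r0); apply: filterS2 s0 => s s0 so v x vs.
by rewrite (le_trans (fd s v x (ltW s0) vs))// ler_wpM2l.
Qed.

(** The hump [c * h] is [f] minus the earlier terms [F] minus the later terms
    [f - (F + c * h)], so it can only be hard to approximate if one of these
    three is.  A fourth, zero summand turns the index of the left side into
    [4 * n]. *)
Lemma best_approx_hump (R : realType) (d : nat)
  (V : nat -> set ('rV[R]_d -> R))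
  (E_sum : forall (m n : nat) (f : 'I_m -> 'rV[R]_d -> R),
     (0 < m)%N -> (0 < n)%N -> (forall k, Ccube (f k)) ->
     (best_approx (V (m * n)%N) (fun x => (\sum_(k < m) f k x)%R)
        <= \sum_(k < m) best_approx (V n) (f k))%E)
  (E_scale : forall (n : nat) (f : 'rV[R]_d -> R) (c : R),
     (0 < n)%N -> Ccube f ->
     best_approx (V n) (fun x => (c * f x)%R)
       = (`|c|%:E * best_approx (V n) f)%E)
  (n : nat) (f F h : 'rV[R]_d -> R) (c : R) :
  (0 < n)%N -> 0 <= c -> Ccube f -> Ccube F -> Ccube h ->
  (1 <= best_approx (V (4 * n)%N) h)%E ->
  (c%:E <= best_approx (V n) f + (best_approx (V n) F +
     best_approx (V n) (fun x => (f x + -1 * (F x + c * h x))%R)))%E.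
Proof.
move=> n0 c0 fc Fc hc h1; set tail := fun x => f x + -1 * (F x + c * h x).
have tailc : Ccube tail.
  by apply: CcubeD => //; apply: CcubeZ; apply: CcubeD => //; exact: CcubeZ.
pose g (i : 'I_4) : 'rV[R]_d -> R := nth (fun=> 0)
  [:: f; (fun x => -1 * F x); (fun x => -1 * tail x); (fun x => 0 * f x)] i.
have gc i : Ccube (g i).
  by case: i => [[|[|[|[|//]]]] lti]; rewrite /g //=; exact: CcubeZ.
apply: (@le_trans _ _ (best_approx (V (4 * n)%N) (fun x => c * h x))).
  rewrite E_scale ?muln_gt0// (ger0_norm c0) -[leLHS]mule1.
  by apply: lee_wpmul2l => //; rewrite lee_fin.
have -> : (fun x => c * h x) = fun x => \sum_(i < 4) g i x.
  by apply/funext => x; rewrite !big_ord_recl big_ord0 /g /= /tail; ring.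
apply: le_trans (E_sum 4%N n g _ n0 gc) _ => //.
rewrite !big_ord_recl big_ord0 /g /= !E_scale// normrN normr1 normr0.
by rewrite !mul1e mul0e !adde0.
Qed.

(** The counterexample is [\sum_k omega (y n_k) * h n_k] for a rapidly
    increasing sequence n_k, where [h n] is hard to approximate at index
    [4 * n] but has r-th differences of order [e ^+ r / y n] for increments of
    length [e].  Each n_k is chosen after the previous ones, and three
    requirements are imposed:
    - the amplitudes decrease so fast that, by the bound [D], the later terms
      are invisible to the process of index n_k;
    - the ratios [omega (y n_k) / y n_k] at least double, so that the sum of
      the r-th differences is dominated by two geometric sums;
    - the partial sum before n_k is approximated at index n_k with an error
      that is small relative to [omega (y n_k)].
    The last one can be met because a partial sum has a modulus of smoothness
    [O(omega (delta ^+ r))]: if its errors were not [o(omega (y n))], it would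
    be the desired function itself. *)
Lemma gliding_hump (R : realType) (d r : nat) (V : nat -> set ('rV[R]_d -> R))
  (E_sum : forall (m n : nat) (f : 'I_m -> 'rV[R]_d -> R),
     (0 < m)%N -> (0 < n)%N -> (forall k, Ccube (f k)) ->
     (best_approx (V (m * n)%N) (fun x => (\sum_(k < m) f k x)%R)
        <= \sum_(k < m) best_approx (V n) (f k))%E)
  (E_scale : forall (n : nat) (f : 'rV[R]_d -> R) (c : R),
     (0 < n)%N -> Ccube f ->
     best_approx (V n) (fun x => (c * f x)%R)
       = (`|c|%:E * best_approx (V n) f)%E)
  (E_bound : exists D : nat -> R, forall (n : nat) (f : 'rV[R]_d -> R),
     (0 < n)%N -> Ccube f ->
     (best_approx (V n) f <= (D n * supnorm (cube R d) f)%:E)%E)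
  (r_gt0 : (0 < r)%N)
  (omega : R -> R) (omega_modulus : abstract_modulus omega)
  (omega_lim : omega delta / delta @[delta --> 0^'+] --> +oo)
  (U : set 'rV[R]_d)
  (y : nat -> R) (y_gt0 : forall n, (0 < n)%N -> 0 < y n)
  (y_lim : y n @[n --> \oo] --> (0 : R))
  (A : R) (A_ge0 : 0 <= A) (n0 : nat) (n0_gt0 : (0 < n0)%N)
  (humps : forall n, (n0 <= n)%N -> exists h : 'rV[R]_d -> R,
    [/\ Ccube h, forall x, `|h x| <= 1, (1 <= best_approx (V (4 * n)%N) h)%E &
      forall e v x, 0 <= e -> eucl_norm v <= e ->
        `|fwd_diff r v h x| <= A /\
        `|fwd_diff r v h x| <= A * (e ^+ r / y n)]) :
  exists f : 'rV[R]_d -> R,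
    [/\ Ccube f,
        radial_modulus U r f
          =O_ (0^'+) (fun delta : R => omega (delta ^+ r)) &
        not_littleo (fun n => best_approx (V n) f) (fun n => omega (y n))].
Proof.
case: E_bound => D ED; pose a n := omega (y n).
have a0 n : (0 < n)%N -> 0 < a n.
  by move=> n1; apply: (modulus_gt0 omega_modulus); exact: y_gt0.
have near_y (P : set R) :
    (\forall s \near 0^'+, P s) -> \forall n \near \oo, P (y n).
  apply: near_right_comp => //.
  by near=> n; apply: y_gt0; near: n; exact: nbhs_infty_gt.
have /choice[h Hh] : forall n, exists h : 'rV[R]_d -> R, (n0 <= n)%N ->
    [/\ Ccube h, forall x, `|h x| <= 1, (1 <= best_approx (V (4 * n)%N) h)%E &
      forall e v x, 0 <= e -> eucl_norm v <= e ->
        `|fwd_diff r v h x| <= A /\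
        `|fwd_diff r v h x| <= A * (e ^+ r / y n)].
  move=> n; have [n1|] := leqP n0 n; last by exists (fun=> 0).
  by have [h ?] := humps n n1; exists h.
apply: contrapT => no_f.
have small f : Ccube f ->
    radial_modulus U r f
      =O_ (0^'+) (fun delta : R => omega (delta ^+ r)) ->
    \forall n \near \oo, (0 < n)%N ->
      (best_approx (V n) f <= (4^-1 * a n)%:E)%E.
  move=> fc fO; have fl : ~ not_littleo (fun n => best_approx (V n) f) a.
    by move=> fl; apply: no_f; exists f.
  have e4 : (0 : R) < 4^-1 by [].
  have := not_littleoPn fl e4.
  by apply: filterS => n fn n1; apply: fn; exact: a0.
have /choice[next Hnext] : forall p : nat * ('rV[R]_d -> R), exists n : nat,
    (0 < p.1)%N -> smooth_of_order r p.2 ->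
    [/\ (n0 <= n)%N, (p.1 < n)%N, 8 * (1 + `|D p.1|) * a n <= a p.1,
        2 * (a p.1 / y p.1) <= a n / y n &
        (best_approx (V n) p.2 <= (4^-1 * a n)%:E)%E].
  move=> [m f] /=.
  have [[m0 fs]|nms] := pselect ((0 < m)%N /\ smooth_of_order r f); last first.
    by exists 0%N => m0 fs; case: nms.
  have am := a0 m m0.
  have D8 : 0 < 8 * (1 + `|D m|) by rewrite mulr_gt0// ltr_pwDl.
  near \oo => n; exists n => _ _.
  have n1 : (n0 <= n)%N by near: n; exact: nbhs_infty_ge.
  split => //.
  - near: n; exact: nbhs_infty_gt.
  - rewrite -ler_pdivlMl//; apply: ltW; near: n.
    apply: (near_y (fun s => omega s < (8 * (1 + `|D m|))^-1 * a m)).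
    by apply: abstract_modulus_near0 => //; rewrite mulr_gt0// invr_gt0.
  - near: n; apply: (near_y (fun s => 2 * (a m / y m) <= omega s / s)).
    by have /cvgryPge := omega_lim; exact.
  - have np : (0 < n)%N by exact: leq_trans n1.
    move: np; near: n; apply: small; first by case: fs.
    exact: smooth_of_order_bigO.
(* The state is the last chosen index with the partial sum up to it. *)
pose st k := iter k (fun p => let n := next p in
  (n, fun x => p.2 x + a n * h n x)) (n0, fun=> 0 : R).
pose n_ k := (st k).1; pose F k := (st k).2.
have FS k : F k.+1 = fun x => F k x + a (n_ k.+1) * h (n_ k.+1) x by [].
have inv k : (n0 <= n_ k)%N /\ smooth_of_order r (F k).
  elim: k => [|k [nk fk]]; first by split => //; exact: smooth_of_order0.
  have [nk1 _ _ _ _] := Hnext (st k) (leq_trans n0_gt0 nk) fk; split => //.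
  have [hc _ _ hd] := Hh _ nk1; have np := leq_trans n0_gt0 nk1.
  apply: smooth_of_orderDZ => //; first exact: ltW (a0 _ np).
  split => //; exists (A / y (next (st k))) => [|e v x e0 ve].
    by rewrite divr_ge0// ltW// y_gt0.
  by rewrite (le_trans (hd e v x e0 ve).2)// mulrAC mulrA.
have n_gt0 k : (0 < n_ k)%N by exact: leq_trans (inv k).1.
have a_gt0 k : 0 < a (n_ k) by exact: a0.
have sep k : [/\ (n_ k < n_ k.+1)%N,
    8 * (1 + `|D (n_ k)|) * a (n_ k.+1) <= a (n_ k),
    2 * (a (n_ k) / y (n_ k)) <= a (n_ k.+1) / y (n_ k.+1) &
    (best_approx (V (n_ k.+1)) (F k) <= (4^-1 * a (n_ k.+1))%:E)%E].
  by have [] := Hnext (st k) (n_gt0 k) (inv k).2.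
have a8 k : 8 * a (n_ k.+1) <= a (n_ k).
  have [_ h8 _ _] := sep k; apply: le_trans h8.
  by rewrite ler_wpM2r ?(ltW (a_gt0 _))// ler_peMr// lerDl.
have a2 k : 2 * a (n_ k.+1) <= a (n_ k).
  by have := a8 k; have := a_gt0 k.+1; lra.
have /choice[f Hf] : forall x, exists L, forall k,
    `|L - F k x| <= 2 * a (n_ k.+1).
  move=> x; apply: nested_limit => k; first by rewrite mulr_ge0// ltW.
  have [_ h1 _ _] := Hh _ (inv k.+1).1.
  have -> : F k.+1 x - F k x = a (n_ k.+1) * h (n_ k.+1) x by rewrite FS; ring.
  rewrite normrM (gtr0_norm (a_gt0 _)).
  have := ler_wpM2l (ltW (a_gt0 k.+1)) (h1 x); rewrite mulr1.
  by have := a8 k.+1; have := a_gt0 k.+2; lra.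
have approx e : 0 < e -> exists k, 2 * a (n_ k.+1) <= e.
  move=> e0; have [k ak] := halving_small e0 (fun k => ltW (a_gt0 k)) a2.
  by exists k; exact: le_trans (a2 k) ak.
have fc : Ccube f.
  apply: uniform_limit_Ccube => e e0; have [k ke] := approx e e0.
  by exists (F k); [exact: (inv k).2.1|move=> x; exact: le_trans (Hf x k) ke].
have fO : radial_modulus U r f
    =O_ (0^'+) (fun delta : R => omega (delta ^+ r)).
  apply: (@radial_modulus_bigO _ _ _ _ _ _ (6 * A)) => //; first exact: mulr_ge0.
  have : \forall s \near (0 : R)^'+, 0 < s by exact: nbhs_right_gt.
  apply: filterS => e e0 v x ve; apply: fwd_diff_limit => eps eps0.
  have [k ke] := approx eps eps0; exists (F k); split.
    by move=> z; exact: le_trans (Hf z k) ke.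
  have er0 : 0 < e ^+ r by exact: exprn_gt0.
  have step j : [/\ `|fwd_diff r v (F j.+1) x|
        <= `|fwd_diff r v (F j) x| + A * a (n_ j.+1) &
      `|fwd_diff r v (F j.+1) x| <= `|fwd_diff r v (F j) x|
        + A * (a (n_ j.+1) / y (n_ j.+1) * e ^+ r)].
    have [_ _ _ /(_ e v x (ltW e0) ve)[d1 d2]] := Hh _ (inv j.+1).1.
    have ak := ltW (a_gt0 j.+1).
    rewrite FS fwd_diffDZ; split; rewrite (le_trans (ler_normD _ _))// lerD2l;
      rewrite normrM (ger0_norm ak).
      by rewrite mulrC ler_wpM2r.
    apply: le_trans (ler_wpM2l ak d2) _.
    by rewrite le_eqVlt; apply/orP; left; apply/eqP; ring.
  apply: (@two_regime_sum _ (fun k => `|fwd_diff r v (F k) x|)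
    (fun k => a (n_ k)) (fun k => y (n_ k)) A (e ^+ r)) => //.
  - by apply: (modulus_ge0 omega_modulus); exact: ltW.
  - by move=> j; exact: y_gt0.
  - by move=> j; exact: ltW.
  - by rewrite fwd_diff0 normr0.
  - by move=> j; have [] := step j.
  - by move=> j; have [] := step j.
  - by move=> j; have [] := sep j.
  - move=> j ye; apply: (modulus_increasing omega_modulus) => //.
    exact: ltW (y_gt0 _ _).
  - by move=> j ey; exact: abstract_modulus_le_ratio.
(* At a large index n, the errors of f, of the terms before n and of the terms
   after n are all at most a n / 4, against a n for the hump itself. *)
have [N _ HN] := small f fc fO.
have n_ge k : (k <= n_ k)%N.
  by elim: k => [//|k IH]; have [nk _ _ _] := sep k; exact: leq_ltn_trans IH nk.
pose n := n_ N.+1; have np : (0 < n)%N by exact: n_gt0.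
have fn := HN n (ltnW (n_ge N.+1)) np.
have [hc h1 hE _] := Hh n (inv N.+1).1.
have [_ _ _ Fn] := sep N; rewrite -/n in Fn.
have an := a0 n np.
have := best_approx_hump E_sum E_scale np (ltW an) fc (inv N).2.1 hc hE.
set tail := fun x => f x + -1 * (F N x + a n * h n x).
have tailn : (best_approx (V n) tail <= (4^-1 * a n)%:E)%E.
  have tailc : Ccube tail.
    by apply: CcubeD => //; apply: CcubeZ; exact: (inv N.+1).2.1.
  apply: le_trans (ED n tail np tailc) _; rewrite lee_fin.
  have [_ h8 _ _] := sep N.+1; rewrite -/n in h8.
  have t0 := supnorm_ge0 (cube R d) tail.
  have t2 : supnorm (cube R d) tail <= 2 * a (n_ N.+2).
    apply: supnorm_le => [|x _]; first by rewrite mulr_ge0// ltW.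
    by rewrite /tail mulN1r; exact: Hf x N.+1.
  apply: (@le_trans _ _ ((1 + `|D n|) * (2 * a (n_ N.+2)))); last by lra.
  apply: le_trans (ler_wpM2r t0 (_ : D n <= 1 + `|D n|)) _.
    by rewrite (le_trans (ler_norm _))// lerDr.
  by rewrite ler_wpM2l// addr_ge0.
move=> an3; have : ((a n)%:E <=
    (4^-1 * a n)%:E + ((4^-1 * a n)%:E + (4^-1 * a n)%:E))%E.
  by apply: le_trans an3 _; rewrite !leeD.
rewrite -!EFinD lee_fin; lra.
Unshelve. all: by end_near. Qed.

Theorem theorem3p2 (R : realType) (d : nat) (d_gt0 : (0 < d)%N)
  (V : nat -> set ('rV[R]_d -> R))
  (V_bounded : forall n g, (0 < n)%N -> V n g ->
     [bounded g x | x in cube R d])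
  (E_sum : forall (m n : nat) (f : 'I_m -> 'rV[R]_d -> R),
     (0 < m)%N -> (0 < n)%N -> (forall k, Ccube (f k)) ->
     (best_approx (V (m * n)%N) (fun x => (\sum_(k < m) f k x)%R)
        <= \sum_(k < m) best_approx (V n) (f k))%E)
  (E_scale : forall (n : nat) (f : 'rV[R]_d -> R) (c : R),
     (0 < n)%N -> Ccube f ->
     best_approx (V n) (fun x => (c * f x)%R)
       = (`|c|%:E * best_approx (V n) f)%E)
  (E_bound : exists D : nat -> R, forall (n : nat) (f : 'rV[R]_d -> R),
     (0 < n)%N -> Ccube f ->
     (best_approx (V n) f <= (D n * supnorm (cube R d) f)%:E)%E)
  (E_mono : forall (n : nat) (f : 'rV[R]_d -> R),
     (0 < n)%N -> Ccube f ->
     (best_approx (V n.+1) f <= best_approx (V n) f)%E)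
  (tau : nat -> nat) (tau_gt0 : forall n, (0 < n)%N -> (0 < tau n)%N)
  (phi : R -> R) (phi_gt0 : forall x, 1 <= x -> 0 < phi x)
  (phi_decr : forall x y, 1 <= x -> x < y -> phi y < phi x)
  (phi_lim : phi x @[x --> +oo] --> (0 : R))
  (phi_doubling : forall lambda : R, 0 < lambda < 1 ->
     exists X0 C : R, [/\ lambda^-1 <= X0, 0 < C &
       forall x, X0 < x -> phi (lambda * x) <= C * phi x])
  (VC_bound : exists (n0 : nat) (C : R), [/\ (0 < n0)%N, 0 < C &
     forall n, (n0 <= n)%N ->
       (VCdim (restr_grid (tau n) (V n)) < ((tau n ^ d)%:R : R)%:E)%E /\
       (tau (4 * n)%N)%:R <= C / phi n%:R])
  (r : nat) (r_gt0 : (0 < r)%N)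
  (omega : R -> R) (omega_modulus : abstract_modulus omega)
  (omega_lim : omega delta / delta @[delta --> 0^'+] --> +oo) :
  exists f : 'rV[R]_d -> R,
    [/\ Ccube f,
        radial_modulus (open_cube R d) r f
          =O_ (0^'+) (fun delta : R => omega (delta ^+ r)) &
        not_littleo (fun n => best_approx (V n) f)
          (fun n => omega (phi n%:R ^+ r))].
case: VC_bound => n0 [C [n0_gt0 C0 VC]].
have [A A_ge0 HA] := @oscillating_function R d r r_gt0.
have phi_nat n : (0 < n)%N -> 0 < phi n%:R.
  by move=> n1; rewrite phi_gt0// ler1n.
apply: (@gliding_hump R d r V E_sum E_scale E_bound r_gt0 omega omega_modulus
  omega_lim _ (fun n => phi n%:R ^+ r) _ _ (A * C ^+ r + 2 ^+ r) _ n0) => //.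
- by move=> n n1; rewrite exprn_gt0// phi_nat.
- have e0 : (0 : R) ^+ r = 0 by rewrite expr0n gtn_eqF.
  rewrite -[X in _ --> X]e0.
  have phin : phi n%:R @[n --> \oo] --> (0 : R).
    by apply: cvg_comp phi_lim; exact: cvgr_idn.
  exact: (cvg_comp _ _ phin (@exprn_continuous R r 0)).
- by rewrite addr_ge0 ?mulr_ge0 ?exprn_ge0// ltW.
(* The hump of index n is the function constructed for V (4 * n); its frequency
   tau (4 * n) is at most C / phi n. *)
move=> n n1; have np : (0 < n)%N by exact: leq_trans n1.
have n4 : (n0 <= 4 * n)%N by rewrite (leq_trans n1)// leq_pmull.
have n4_gt0 : (0 < 4 * n)%N by rewrite muln_gt0.
have phin := phi_nat n np.
have [|h [hc h1 hE hd]] := HA _ _ (tau_gt0 _ n4_gt0) _ (VC _ n4).1.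
  by move=> g; exact: V_bounded.
exists h; split => // e v x e0 ve; split.
  rewrite fwd_diffE (le_trans (iter_fdiff_norm _ _ _ h1))// mul1r lerDr.
  by rewrite mulr_ge0// exprn_ge0// ltW.
rewrite (le_trans (hd e v x e0 ve))// mulrDl.
apply: (@le_trans _ _ (A * C ^+ r * (e ^+ r / phi n%:R ^+ r))); last first.
  by rewrite lerDl !mulr_ge0// ?exprn_ge0// invr_ge0 exprn_ge0// ltW.
rewrite -mulrA ler_wpM2l//.
have -> : C ^+ r * (e ^+ r / phi n%:R ^+ r) = (C / phi n%:R * e) ^+ r.
  by rewrite !exprMn exprVn; ring.
rewrite lerXn2r ?nnegrE ?mulr_ge0 ?invr_ge0 ?(ltW C0) ?(ltW phin)//.
by rewrite ler_wpM2r//; exact: (VC _ n1).2.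
Qed.
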